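(* Let $\Gamma\subseteq\mathfrak{S}$ be a set of permutations, each of length at least $2$. Then \[ \frac{1}{1-t}\sum_{n=0}^{\infty}P_{\Gamma,n}^{\mathrm{ilpk}}(s,u)z^{n}=\sum_{n=0}^{\infty}\left(\frac{z}{1-t}+\frac{1}{1-t}\sum_{k=2}^{\infty}R_{\Gamma,k}^{\mathrm{ilpk}}(s-1,u)z^{k}\right)^{*\langle n\rangle} \] where $u=4t/(1+t)^{2}$ and $z=(1+t)x/(1-t)$.
   Context: $\mathfrak{S}_n$ is the set of permutations of $[n]$ in one-line notation ($\mathfrak{S}_0$ = empty permutation), $\mathfrak{S}=\bigsqcup_n\mathfrak{S}_n$. $\operatorname{std}$ of a sequence of distinct integers replaces its letters by $1,2,\dots$ in order of size. For $\pi\in\mathfrak{S}_n$, $\sigma\in\mathfrak{S}_m$, an occurrence of $\sigma$ in $\pi$ is an $i\in[n-m+1]$ with $\operatorname{std}(\pi_i\cdots\pi_{i+m-1})=\sigma$; a marked occurrence of a pattern in $\Gamma$ is a pair $(i,\sigma)$, $\sigma\in\Gamma$, $i$ an occurrence of $\sigma$; $\operatorname{occ}_\Gamma(\pi)$ is the number of such pairs. A $\Gamma$-cluster on $\pi\in\mathfrak{S}_n$ is a nonempty set $c$ of marked occurrences such that for every $j\in[n-1]$ some $(i,\sigma)\in c$, $\sigma\in\mathfrak{S}_m$, has $i\le j<i+m-1$; $C_{\Gamma,\pi}$ is the set of these, $\operatorname{mk}_\Gamma(c)=|c|$. A left peak of $\pi\in\mathfrak{S}_n$ is $i\in\{2,\dots,n-1\}$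 with $\pi_{i-1}<\pi_i>\pi_{i+1}$, or $i=1$ if $n\ge2$ and $\pi_1>\pi_2$; $\operatorname{lpk}(\pi)$ is the number of left peaks and $\operatorname{ilpk}(\pi)=\operatorname{lpk}(\pi^{-1})$. $P_{\Gamma,n}^{\mathrm{ilpk}}(s,t)=\sum_{\pi\in\mathfrak{S}_n}s^{\operatorname{occ}_\Gamma(\pi)}t^{\operatorname{ilpk}(\pi)}$ for $n\ge1$ and $=1$ for $n=0$; $R_{\Gamma,k}^{\mathrm{ilpk}}(s,t)=\sum_{\pi\in\mathfrak{S}_k}t^{\operatorname{ilpk}(\pi)}\sum_{c\in C_{\Gamma,\pi}}s^{\operatorname{mk}_\Gamma(c)}$. The identity is in formal power series in $s,t,x$ with ordinary multiplication in $s,x$ and Hadamard product in $t$: $(\sum_n a_nt^n)*(\sum_n b_nt^n)=\sum_n a_nb_nt^n$; $f^{*\langle n\rangle}$ is the $n$-fold Hadamard product, $f^{*\langle0\rangle}=1/(1-t)$. Other expressions use ordinary multiplication. *)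

(* Defs.v *)
From HB Require Import structures.
From mathcomp Require Import all_boot all_order all_algebra all_fingroup.
From mathcomp Require Import boolp classical_sets functions cardinality fsbigop.

Set Implicit Arguments.
Unset Strict Implicit.
Unset Printing Implicit Defensive.

Import GRing.Theory.

Local Open Scope ring_scope.

Record fps (A : Type) := Fps { fps_coef :> nat -> A }.

HB.instance Definition _ (A : Type) := gen_eqMixin (fps A).
HB.instance Definition _ (A : Type) := gen_choiceMixin (fps A).

Lemma fpsP (A : Type) (f g : fps A) : f =1 g -> f = g.
Proof. by case: f g => [f] [g] /= /funext ->. Qed.

Section FpsZmod.
Variable A : zmodType.

Definition fps_zero : fps A := Fps (fun=> 0).
Definition fps_opp (f : fps A) : fps A := Fps (fun n => - f n).
Definition fps_add (f g : fps A) : fps A := Fps (fun n => f n + g n).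

Fact fps_addA : associative fps_add.
Proof. by move=> f g h; apply: fpsP => n /=; rewrite addrA. Qed.
Fact fps_addC : commutative fps_add.
Proof. by move=> f g; apply: fpsP => n /=; rewrite addrC. Qed.
Fact fps_add0 : left_id fps_zero fps_add.
Proof. by move=> f; apply: fpsP => n /=; rewrite add0r. Qed.
Fact fps_addN : left_inverse fps_zero fps_opp fps_add.
Proof. by move=> f; apply: fpsP => n /=; rewrite addNr. Qed.

HB.instance Definition _ :=
  GRing.isZmodule.Build (fps A) fps_addA fps_addC fps_add0 fps_addN.
End FpsZmod.

Section FpsRing.
Variable A : comNzRingType.
Implicit Types f g h : fps A.

Definition fps_const (a : A) : fps A := Fps (fun n => if n == 0%N then a else 0).
Definition fps_X : fps A := Fps (fun n => (n == 1%N)%:R).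
Definition fps_mul f g : fps A :=
  Fps (fun n => \sum_(i < n.+1) f i * g (n - i)%N).

Definition fps_trunc (n : nat) f : {poly A} := \poly_(i < n.+1) f i.

Lemma coef_fps_trunc n f i : (i <= n)%N -> (fps_trunc n f)`_i = f i.
Proof. by move=> le_in; rewrite coef_poly ltnS le_in. Qed.

Lemma fps_mul_trunc n f g i : (i <= n)%N ->
  fps_mul f g i = (fps_trunc n f * fps_trunc n g)`_i.
Proof.
move=> le_in; rewrite coefM; apply: eq_bigr => j _.
rewrite !coef_fps_trunc //; first exact: leq_trans (leq_subr _ _) le_in.
by apply: leq_trans le_in; rewrite -ltnS.
Qed.

Fact fps_mulA : associative fps_mul.
Proof.
move=> f g h; apply: fpsP => n.
have -> : fps_mul f (fps_mul g h) n
    = (fps_trunc n f * (fps_trunc n g * fps_trunc n h))`_n.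
  rewrite coefM; apply: eq_bigr => j _.
  have le_jn : (j <= n)%N by rewrite -ltnS.
  by rewrite coef_fps_trunc // (@fps_mul_trunc n) ?leq_subr.
rewrite mulrA coefM; apply: eq_bigr => j _.
have le_jn : (j <= n)%N by rewrite -ltnS.
by rewrite coef_fps_trunc ?leq_subr // -(@fps_mul_trunc n).
Qed.

Fact fps_mulC : commutative fps_mul.
Proof.
by move=> f g; apply: fpsP => n; rewrite !(@fps_mul_trunc n) // mulrC.
Qed.

Fact fps_mul1 : left_id (fps_const 1) fps_mul.
Proof.
move=> f; apply: fpsP => n /=; rewrite big_ord_recl /= mul1r subn0 big1 ?addr0 //.
by move=> i _; rewrite mul0r.
Qed.

Fact fps_mulD : left_distributive fps_mul +%R.
Proof.
move=> f g h; apply: fpsP => n /=; rewrite -big_split /=.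
by apply: eq_bigr => i _; rewrite mulrDl.
Qed.

Fact fps_1neq0 : fps_const 1 != 0.
Proof.
by apply/eqP => /(congr1 (fun f : fps A => f 0%N)) /= /eqP; rewrite oner_eq0.
Qed.

HB.instance Definition _ := GRing.Zmodule_isComNzRing.Build (fps A)
  fps_mulA fps_mulC fps_mul1 fps_mulD fps_1neq0.

Definition fps_unit : {pred fps A} := fun f => `[< exists g, g * f = 1 >].
Definition fps_inv f : fps A := xget f [set g | g * f = 1].

Fact fps_mulVx : {in fps_unit, left_inverse 1 fps_inv *%R}.
Proof.
move=> f /asboolP[g gf]; rewrite /fps_inv.
by case: xgetP => [h _ //|/(_ g)]; case.
Qed.
Fact fps_unitPl f g : g * f = 1 -> fps_unit f.
Proof. by move=> gf; apply/asboolP; exists g. Qed.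
Fact fps_inv_out : {in [predC fps_unit], fps_inv =1 id}.
Proof.
move=> f nf; rewrite /fps_inv; case: xgetP => // g _ gf.
by move/negP: nf; case; exact: fps_unitPl gf.
Qed.

HB.instance Definition _ := GRing.ComNzRing_hasMulInverse.Build (fps A)
  fps_mulVx fps_unitPl fps_inv_out.

Lemma fps_addE f g n : (f + g) n = f n + g n. Proof. by []. Qed.
Lemma fps_oppE f n : (- f) n = - f n. Proof. by []. Qed.
Lemma fps_mulE f g n : (f * g) n = \sum_(i < n.+1) f i * g (n - i)%N.
Proof. by []. Qed.
Lemma fps_oneE n : (1 : fps A) n = (n == 0%N)%:R.
Proof. by rewrite /GRing.one /=; case: eqP. Qed.

Lemma fps_sumE (I : Type) (r : seq I) (Q : pred I) (F : I -> fps A) n :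
  (\sum_(i <- r | Q i) F i) n = \sum_(i <- r | Q i) F i n.
Proof. by elim/big_rec2: _ => // i y1 y2 _ <-. Qed.

(* In particular 1 - t and 1 + t are invertible, whatever the coefficient ring. *)
Lemma fps_unitE f : f 0%N = 1 -> f \is a GRing.unit.
Proof.
move=> f0; pose u := 1 - f.
have u0 : u 0%N = 0 by rewrite fps_addE fps_oppE fps_oneE f0 subrr.
have uX n k : (k < n)%N -> (u ^+ n) k = 0.
  elim: n k => // n IHn k le_kn; rewrite exprSr fps_mulE big1 // => i _.
  have [lt_in|le_ni] := ltnP i n; first by rewrite IHn // mul0r.
  suff -> : (k - i = 0)%N by rewrite u0 mulr0.
  by apply/eqP; rewrite subn_eq0 (leq_trans _ le_ni).
have fE : f = 1 - u by rewrite opprB addrC subrK.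
pose g := Fps (fun n => (\sum_(i < n.+1) u ^+ i) n).
apply/asboolP; exists g; apply: fpsP => n.
have gE k : (k <= n)%N -> g k = (\sum_(i < n.+1) u ^+ i) k.
  move=> le_kn; rewrite /= !fps_sumE -(subnKC le_kn) -addSn big_split_ord /=.
  by rewrite [X in _ + X]big1 ?addr0 // => i _; rewrite uX // leq_addr.
transitivity (((\sum_(i < n.+1) u ^+ i) * f) n).
  by rewrite !fps_mulE; apply: eq_bigr => i _; rewrite gE // -ltnS.
rewrite fE mulrC -[1 - u]opprB mulNr -subrX1 opprB fps_addE fps_oppE.
by rewrite uX // subr0.
Qed.

End FpsRing.

Definition hadamard (A : comNzRingType) (f g : fps A) : fps A :=
  Fps (fun n => f n * g n).

Definition hadamard_exp (A : comNzRingType) (f : fps A) (n : nat) : fps A :=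
  iter n (hadamard f) (1 - fps_X A)^-1.

(* The outermost variable is t, the innermost one is s: the coefficients of
   t^n are series in s and x, so that [hadamard] is the Hadamard product in t
   and multiplication of coefficients is the ordinary product in s and x.
   [f i j k] is the coefficient of t^i x^j s^k. *)
Definition fps3 (R : comNzRingType) := fps (fps (fps R)).

Definition var_t (R : comNzRingType) : fps3 R := fps_X (fps (fps R)).
Definition var_x (R : comNzRingType) : fps3 R := fps_const (fps_X (fps R)).
Definition var_s (R : comNzRingType) : fps3 R :=
  fps_const (fps_const (fps_X R)).

(* Infinite sum of a family of series; it is meaningful for summable families
   (the finite-support sum [\sum_(n \in D) _] is 0 on infinite supports). *)
Definition summable (R : comNzRingType) (D : set nat) (F : nat -> fps3 R) :=
  forall i j k : nat, finite_set [set n | D n /\ F n i j k != 0].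

Definition fps_sum (R : comNzRingType) (D : set nat) (F : nat -> fps3 R) :
    fps3 R :=
  Fps (fun i => Fps (fun j => Fps (fun k => \sum_(n \in D) F n i j k))).

(* The disjoint union of all symmetric groups; 'S_n permutes {0, ..., n-1}. *)
Definition permutation := {n : nat & 'S_n}.

Definition one_line (n : nat) (p : 'S_n) : seq nat :=
  [seq (p i).+1 | i <- enum 'I_n].

Definition std (w : seq nat) : seq nat :=
  [seq (count (fun y => y < x)%N w).+1 | x <- w].

(* Positions are numbered from 0 here: [i] stands for the position i + 1. *)
Definition occurrence (n m : nat) (p : 'S_n) (q : 'S_m) (i : nat) : bool :=
  (i + m <= n)%N && (std (take m (drop i (one_line p))) == one_line q).

(* Candidates for marked occurrences in a permutation of length n: only
   positions i <= n and patterns of length m <= n are possible, so they form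
   a finite type. *)
Definition mark (n : nat) := ('I_n.+1 * {m : 'I_n.+1 & 'S_m})%type.

Definition mark_pos (n : nat) (a : mark n) : nat := a.1.
Definition mark_len (n : nat) (a : mark n) : nat := tag a.2.
Definition mark_pat (n : nat) (a : mark n) : permutation :=
  Tagged (fun m => 'S_m) (tagged a.2).

Section Patterns.
Variable Gamma : set permutation.

Definition marked_occurrences (n : nat) (p : 'S_n) : {set mark n} :=
  [set a : mark n | (mark_pat a \in Gamma) &&
                    occurrence p (tagged a.2) (mark_pos a)].

Definition occ (n : nat) (p : 'S_n) : nat := #|marked_occurrences p|.

Definition is_cluster (n : nat) (p : 'S_n) (c : {set mark n}) : bool :=
  [&& c \subset marked_occurrences p, c != finset.set0 &
      [forall j : 'I_n.-1, exists a in c,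
         (mark_pos a <= j)%N && (j.+1 < mark_pos a + mark_len a)%N]].

End Patterns.

(* Again [i] stands for the position i + 1. *)
Definition left_peak (n : nat) (p : 'S_n) (i : nat) : bool :=
  let w := one_line p in
  [&& (i.+1 < n)%N, (nth 0%N w i.+1 < nth 0%N w i)%N &
      (i == 0%N) || (nth 0%N w i.-1 < nth 0%N w i)%N].

Definition lpk (n : nat) (p : 'S_n) : nat :=
  #|[set i : 'I_n | left_peak p i]|.

Definition ilpk (n : nat) (p : 'S_n) : nat := lpk (p^-1)%g.

(* The polynomials P and R have natural number coefficients; they are given
   through their values at the elements a, b of any commutative ring. *)
Definition P_ilpk (A : comNzRingType) (Gamma : set permutation) (n : nat)
    (a b : A) : A :=
  if n is 0%N then 1 else \sum_(p : 'S_n) a ^+ occ Gamma p * b ^+ ilpk p.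

Definition R_ilpk (A : comNzRingType) (Gamma : set permutation) (k : nat)
    (a b : A) : A :=
  \sum_(p : 'S_k) b ^+ ilpk p *
    \sum_(c : {set mark k} | is_cluster Gamma p c) a ^+ #|c|.

(* A family whose n-th member has order at least n in x is summable, which is
   how the sums over powers of z and over Hadamard powers make sense. *)
Section Order.
Variable R : comNzRingType.
Implicit Types f g : fps3 R.

Definition xorder_ge (n : nat) (f : fps3 R) :=
  forall i j : nat, (j < n)%N -> f i j = 0.

Lemma summable_xorder (D : set nat) (F : nat -> fps3 R) :
  (forall n, D n -> xorder_ge n (F n)) -> summable D F.
Proof.
move=> FP i j k; apply: (@sub_finite_set _ _ `I_j.+1); last exact: finite_II.
move=> n /= [Dn]; apply: contraNT; rewrite -leqNgt => lt_jn.
by rewrite FP.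
Qed.

Lemma xorder_ge0 f : xorder_ge 0 f. Proof. by []. Qed.

Lemma xorder_geM n m f g :
  xorder_ge n f -> xorder_ge m g -> xorder_ge (n + m) (f * g).
Proof.
move=> fP gP i j lt_j; rewrite fps_mulE fps_sumE big1 // => a _.
rewrite fps_mulE big1 // => b _.
have [lt_bn|le_nb] := ltnP b n; first by rewrite fP // mul0r.
rewrite gP ?mulr0 // ltn_subLR; last by rewrite -ltnS.
by apply: leq_trans lt_j _; rewrite leq_add2r.
Qed.

Lemma xorder_geX n f : xorder_ge 1 f -> xorder_ge n (f ^+ n).
Proof.
by move=> fP; elim: n => // n IHn; rewrite exprS -add1n; apply: xorder_geM.
Qed.

Lemma xorder_geD n f g : xorder_ge n f -> xorder_ge n g -> xorder_ge n (f + g).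
Proof. by move=> fP gP i j lt_jn; rewrite !fps_addE fP // gP // addr0. Qed.

Lemma xorder_ge_hadamard_exp n f :
  xorder_ge 1 f -> xorder_ge n (hadamard_exp f n).
Proof.
move=> fP; elim: n => // n IHn i j lt_jn.
rewrite /hadamard_exp iterS fps_mulE big1 // => -[[|b] /= lt_b] _.
  by rewrite fP // mul0r.
rewrite IHn ?mulr0 //; case: j lt_jn lt_b => // j; rewrite ltnS => lt_jn _.
exact: leq_ltn_trans (leq_subr _ _) lt_jn.
Qed.

Lemma xorder_ge_sum m (D : set nat) (F : nat -> fps3 R) :
  (forall n, D n -> xorder_ge m (F n)) -> xorder_ge m (fps_sum D F).
Proof.
move=> FP i j lt_jm; apply: fpsP => k /=.
by rewrite fsbig1 // => n Dn; rewrite FP.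
Qed.

Lemma xorder_ge_x f g : xorder_ge 1 (f * var_x R / g).
Proof.
rewrite -[1%N]addn0; apply: xorder_geM => //.
rewrite -[1%N]add0n; apply: xorder_geM => // i [|j] //= _.
by case: eqP => // _; apply: fpsP.
Qed.

End Order.

(* Main.v *)
(* The series u^(lpk q) z^n / (1 - t) is x^n times the generating function, over
   i, of the number of left enriched q-partitions with letters
   0 < -1 < 1 < ... < -i < i (Stembridge, Petersen). Summing over all
   permutations p with q = p^-1, the coefficient of t^i on the left-hand side
   counts all words over these 2i+1 letters, each weighted by the occurrences in
   its standardization. Hadamard products in t are products of the coefficients
   of t^i, so for each i the claim is the classical cluster method for words: a
   word with a set of marked factors is uniquely a concatenation of single
   letters and clusters, whence W = 1 + F W and W = 1 + F + F^2 + ... *)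
Require Import Defs.
From HB Require Import structures.
From mathcomp Require Import all_boot all_order all_algebra all_fingroup.
From mathcomp Require Import boolp classical_sets functions cardinality fsbigop.
From mathcomp Require Import zify ring.

Set Implicit Arguments.
Unset Strict Implicit.
Unset Printing Implicit Defensive.

Import GRing.Theory.

Local Open Scope ring_scope.

(** * Coefficients of products, geometric series and Hadamard powers *)

Section Series.
Variable A : comNzRingType.
Implicit Types f g : fps A.

Lemma fps_subE f g n : (f - g) n = f n - g n. Proof. by []. Qed.

Lemma fps_const_mulE (a : A) f n : (fps_const a * f) n = a * f n.
Proof.
rewrite fps_mulE big_ord_recl /= subn0 big1 ?addr0 // => i _.
by rewrite mul0r.
Qed.

Fact fps_const_is_zmod_morphism : zmod_morphism (@fps_const A).
Proof. by move=> a b; apply: fpsP => -[|n] //; rewrite fps_subE /= subr0. Qed.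

Fact fps_const_is_monoid_morphism : monoid_morphism (@fps_const A).
Proof.
split=> // a b; apply: fpsP => n; rewrite fps_const_mulE /=.
by case: eqP => _ //; rewrite mulr0.
Qed.

HB.instance Definition _ :=
  GRing.isZmodMorphism.Build A (fps A) (@fps_const A) fps_const_is_zmod_morphism.
HB.instance Definition _ :=
  GRing.isMonoidMorphism.Build A (fps A) (@fps_const A)
    fps_const_is_monoid_morphism.

Lemma fps_XmulE f n : (fps_X A * f) n = if n is m.+1 then f m else 0.
Proof.
rewrite fps_mulE big_ord_recl /= mul0r add0r.
case: n => [|n]; first by rewrite big_ord0.
rewrite big_ord_recl /= mul1r subn1 /= big1 ?addr0 // => i _.
by rewrite mul0r.
Qed.

Lemma fps_XnmulE m f n :
  (fps_X A ^+ m * f) n = if (m <= n)%N then f (n - m)%N else 0.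
Proof.
elim: m n => [|m IHm] n; first by rewrite mul1r subn0.
by rewrite exprS -mulrA fps_XmulE; case: n => [|n] //; rewrite IHm.
Qed.

Lemma fps_unit_1subX : 1 - fps_X A \is a GRing.unit.
Proof. by apply: fps_unitE; rewrite fps_subE fps_oneE subr0. Qed.

Lemma fps_unit_1addX : 1 + fps_X A \is a GRing.unit.
Proof. by apply: fps_unitE; rewrite fps_addE fps_oneE addr0. Qed.

Lemma fps_geometricE n : (1 - fps_X A)^-1 n = 1.
Proof.
suff -> : (1 - fps_X A)^-1 = Fps (fun=> 1) by [].
apply: (mulrI fps_unit_1subX); rewrite mulrV ?fps_unit_1subX //.
apply: fpsP => m; rewrite mulrBl mul1r fps_subE fps_XmulE fps_oneE /=.
by case: m => [|m] /=; rewrite ?subr0 ?subrr.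
Qed.

(** The iteration starts at 1/(1 - t), whose coefficients are all 1. *)
Lemma hadamard_expE f n i : hadamard_exp f n i = f i ^+ n.
Proof.
elim: n => [|n IHn]; first exact: fps_geometricE.
by rewrite exprS -IHn.
Qed.

(* F has no constant term, so 1 + F + ... + F^n agrees with W up to order n. *)
Lemma fps_geometric_solution (F W : fps A) : F 0%N = 0 -> W = 1 + F * W ->
  forall n, \sum_(k < n.+1) (F ^+ k) n = W n.
Proof.
move=> F0 WE n.
have FX : F = fps_X A * Fps (fun k => F k.+1).
  by apply: fpsP => k; rewrite fps_XmulE; case: k.
have WX m : W = \sum_(k < m) F ^+ k + F ^+ m * W.
  elim: m => [|m IHm]; first by rewrite big_ord0 mul1r add0r.
  rewrite big_ord_recr /= {1}IHm -[in RHS]addrA; congr (_ + _).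
  by rewrite {1}WE mulrDr mulr1 mulrA -exprSr.
rewrite [RHS](congr1 (fun f : fps A => f n) (WX n.+1)) fps_addE fps_sumE.
by rewrite FX exprMn -mulrA fps_XnmulE ltnn addr0.
Qed.

End Series.

(** * Enriched partitions as chains of letters, and their generating function *)

(* Letters 0, 1, ..., 2i stand for 0 < -1 < 1 < ... < -i < i: an even letter may
   be repeated at a rise (e = false), an odd one at a fall (e = true). *)
Definition step (e : bool) (b c : nat) : bool := (b < c + (odd c == e))%N.

(* Starting from a virtual letter 0 matches the convention that a permutation
   starts with a rise in the definition of left peaks. *)
Fixpoint chain_count (d : nat -> bool) (n c : nat) : nat :=
  if n is m.+1 then (\sum_(b < c + (odd c == d m)) chain_count d m b)%N
  else (c == 0)%N.

(** Here [d r] tells whether the step into position [r] is a fall, so this counts the rises directly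
    followed by a fall. *)
Definition rise_falls (d : nat -> bool) (n : nat) : nat :=
  (\sum_(r < n.-1) (~~ d r && d r.+1))%N.

Section ChainSeries.
Variables (A : comNzRingType) (d : nat -> bool).
Hypothesis d0 : d 0%N = false.

Local Notation t := (fps_X A).
Let g : fps A := (1 - t)^-1.
Let h : fps A := (1 + t)^-1.

Let gK : (1 - t) * g = 1.
Proof. by rewrite mulrV ?fps_unit_1subX. Qed.
Let hK : (1 + t) * h = 1.
Proof. by rewrite mulrV ?fps_unit_1addX. Qed.

(** The letters -j and j, coded 2j - 1 and 2j, are both recorded at t^j. In [all_ends] the
    coefficient of t^j counts the chains whose last code is at most 2j. *)
Let even_ends n : fps A := Fps (fun j => (chain_count d n j.*2)%:R).
Let odd_ends n : fps A :=
  Fps (fun j => if j is j'.+1 then (chain_count d n j'.*2.+1)%:R else 0).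
Let all_ends n : fps A :=
  Fps (fun j => (\sum_(c < j.*2.+1) chain_count d n c)%:R).

Let all_endsE n : all_ends n = (even_ends n + odd_ends n) * g.
Proof.
suff <- : (1 - t) * all_ends n = even_ends n + odd_ends n.
  by rewrite mulrAC gK mul1r.
apply: fpsP => j; rewrite mulrBl mul1r fps_subE fps_XmulE fps_addE /=.
case: j => [|j]; first by rewrite big_ord1 subr0 addr0.
rewrite doubleS !big_ord_recr /= !natrD; ring.
Qed.

(** The code 2j may follow every code up to 2j, itself included, and 2j + 1 may follow the same
    codes. The latter is recorded at t^(j+1), which gives the factor t. *)
Let ends_rise n : d n = false ->
  even_ends n.+1 = all_ends n /\ odd_ends n.+1 = t * all_ends n.
Proof.
move=> dn; split; apply: fpsP => j.
  by rewrite /= dn odd_double eqxx addn1.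
by rewrite fps_XmulE; case: j => [|j] //=; rewrite dn odd_double addn0.
Qed.

(** Now only odd codes may be repeated, so 2j - 1 and 2j have the same predecessors, the codes below
    2j. *)
Let ends_fall n : d n ->
  even_ends n.+1 = all_ends n - even_ends n /\ odd_ends n.+1 = even_ends n.+1.
Proof.
move=> dn; split; apply: fpsP => j.
  by rewrite fps_subE /= dn odd_double addn0 big_ord_recr /= natrD addrK.
case: j => [|j] /=; first by rewrite dn big_ord0.
by rewrite dn doubleS /= odd_double /= addn0 addn1.
Qed.

Let u : fps A := 4%:R * t / (1 + t) ^+ 2.
Let v : fps A := (1 + t) / (1 - t).

(** Induction on the length; the second conjunct remembers the last step. A rise, and also a fall
    after a fall, multiplies the sum by v. A fall after a rise turns (1 + t)E into 4tE/(1 - t),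
    where E is the series of even ends before the fall; this is the factor uv. *)
Let ends_sum n :
  even_ends n + odd_ends n = u ^+ rise_falls d n * v ^+ n /\
  ((0 < n)%N -> odd_ends n = (if d n.-1 then 1 else t) * even_ends n).
Proof.
have rise m : d m = false ->
    even_ends m.+1 + odd_ends m.+1 = v * (even_ends m + odd_ends m).
  by case/ends_rise=> -> ->; rewrite all_endsE /v -/g; ring.
elim: n => [|n [IHs IHo]].
  rewrite /rise_falls big_ord0 mulr1; split=> //.
  by apply: fpsP => -[|[|j]]; rewrite fps_addE fps_oneE /= ?addr0.
have [dn|/negbTE dn] := boolP (d n); last first.
  rewrite rise // IHs; split; last first.
    by case: (ends_rise dn) => -> ->.
  suff -> : rise_falls d n.+1 = rise_falls d n by rewrite exprS; ring.
  rewrite /rise_falls; case: (n) dn => [|m] dn; first by rewrite !big_ord0.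
  by rewrite big_ord_recr /= dn andbF addn0.
case: (ends_fall dn) => evenE oddE.
rewrite mul1r {1}oddE; split=> //.
case: n IHs IHo dn evenE {oddE} => [|n] IHs IHo dn evenE.
  by rewrite d0 in dn.
have -> : rise_falls d n.+2 = (rise_falls d n.+1 + ~~ d n)%N.
  by rewrite /rise_falls /= big_ord_recr /= dn andbT.
have -> : u ^+ (rise_falls d n.+1 + ~~ d n) * v ^+ n.+2 =
    (even_ends n.+1 + odd_ends n.+1) * (u ^+ (~~ d n) * v).
  by rewrite IHs exprD (exprS v n.+1); ring.
rewrite evenE all_endsE (IHo isT) [n.+1.-1]/=; case: (d n) => /=.
  have -> : v = g + g - (1 - t) * g by rewrite /v -/g; ring.
  by rewrite gK; ring.
have -> : u ^+ 1 * v = 4%:R * t * h * g.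
  rewrite -[RHS]mulr1 -[X in _ = _ * X]hK expr1 /u /v expr2.
  by rewrite invrM ?fps_unit_1addX // -/g -/h; ring.
transitivity (4%:R * t * g * even_ends n.+1 * ((1 + t) * h)); last by ring.
rewrite hK; transitivity
  ((even_ends n.+1 + t * even_ends n.+1) * g * 2%:R
     - 2%:R * even_ends n.+1 * ((1 - t) * g)); last by ring.
by rewrite gK; ring.
Qed.

Lemma chain_count_series n :
  (1 - t)^-1 * (u ^+ rise_falls d n * v ^+ n) =
  Fps (fun i => (\sum_(c < i.*2.+1) chain_count d n c)%:R).
Proof. by case: (ends_sum n) => <- _; rewrite -/g mulrC -all_endsE. Qed.

End ChainSeries.


(** * Words over an alphabet of [K] letters, and the chains among them *)

Fixpoint words (K n : nat) : seq (seq nat) :=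
  if n is m.+1 then [seq a :: w | a <- iota 0 K, w <- words K m] else [:: [::]].

Lemma mem_words K n w :
  (w \in words K n) = (size w == n) && all (fun a => a < K)%N w.
Proof.
elim: n w => [|n IHn] [|a w] //=; first by apply/allpairsP => -[[b v] /= []].
rewrite eqSS andbCA -IHn; apply/allpairsP/andP => [[[b v] /= []]|[aK wn]].
  by rewrite mem_iota add0n => bK vn [-> ->].
by exists (a, w); rewrite /= mem_iota add0n.
Qed.

Lemma uniq_words K n : uniq (words K n).
Proof.
elim: n => // n IHn; apply: allpairs_uniq => //; first exact: iota_uniq.
by move=> [a v] [b w] _ _ /= [-> ->].
Qed.

Lemma size_words K n w : w \in words K n -> size w = n.
Proof. by rewrite mem_words => /andP[/eqP]. Qed.

Lemma big_words_cat (V : nmodType) K m n (f : seq nat -> V) :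
  \sum_(w <- words K (m + n)) f w =
  \sum_(v <- words K m) \sum_(w <- words K n) f (v ++ w).
Proof.
elim: m f => [|m IHm] f; first by rewrite big_seq1.
rewrite addSn !big_allpairs_dep /=; apply: eq_bigr => a _.
exact: (IHm (fun w => f (a :: w))).
Qed.

Definition chain (d : nat -> bool) (w : seq nat) : bool :=
  all (fun r => step (d r) (nth 0 (0 :: w) r)%N (nth 0 w r)%N) (iota 0 (size w)).

Lemma chain_rcons d w c :
  chain d (rcons w c) = chain d w && step (d (size w)) (last 0%N w) c.
Proof.
rewrite /chain size_rcons -addn1 iotaD all_cat /= andbT add0n; congr (_ && _).
  apply: eq_in_all => r; rewrite mem_iota add0n /= => r_lt.
  by rewrite -rcons_cons !nth_rcons /= r_lt ltnW.
by rewrite nth_rcons ltnn eqxx -rcons_cons nth_rcons /= ltnSn -last_nth.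
Qed.

(** Removing the last letter of a chain gives the recursion of [chain_count]. Chains never decrease,
    so all letters before [c] stay below [K]. *)
Lemma chain_countE d K n c : (c < K)%N ->
  chain_count d n c =
  (\sum_(w <- words K n) (chain d w && (last 0%N w == c)))%N.
Proof.
elim: n c => [|n IHn] c lt_cK; first by rewrite big_seq1 /= eq_sym.
have -> : (\sum_(w <- words K n.+1) (chain d w && (last 0%N w == c)))%N =
    (\sum_(w <- words K n) \sum_(a <- iota 0 K)
       (chain d w && step (d n) (last 0%N w) a && (a == c)))%N.
  rewrite -addn1 big_words_cat; apply: eq_big_seq => w wn.
  rewrite big_allpairs_dep /=; apply: eq_bigr => a _.
  by rewrite big_seq1 cats1 chain_rcons last_rcons (size_words wn).
transitivity (\sum_(w <- words K n)
    \sum_(b < c + (odd c == d n)) (chain d w && (last 0%N w == b)))%N.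
  rewrite exchange_big /=; apply: eq_bigr => b _; apply: IHn.
  by case: b => b /=; case: (_ == _) => /=; lia.
apply: eq_bigr => w _; rewrite (bigD1_seq c) ?iota_uniq ?mem_iota //= eqxx andbT.
rewrite [in RHS]big1 ?addn0 => [|a /negbTE ->]; last by rewrite andbF.
case: (chain d w) => /=; last by rewrite big1.
rewrite /step; set m := (c + _)%N.
have [lt_m|le_m] := ltnP.
  rewrite (bigD1 (Ordinal lt_m)) //= eqxx big1 // => b.
  by rewrite -val_eqE /= eq_sym => /negbTE ->.
rewrite big1 // => b _; case: eqP => // lastE.
by have := ltn_ord b; rewrite -lastE ltnNge le_m.
Qed.

Lemma sum_chain_count d K n : (0 < K)%N ->
  (\sum_(c < K) chain_count d n c = \sum_(w <- words K n) chain d w)%N.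
Proof.
move=> K_gt0.
rewrite (eq_bigr _ (fun (c : 'I_K) _ => chain_countE d n (ltn_ord c))).
rewrite exchange_big /=; apply: eq_big_seq => w.
rewrite mem_words => /andP[_ wK].
have lt_last : (last 0%N w < K)%N.
  by case/lastP: w wK => //= w a; rewrite all_rcons last_rcons => /andP[].
rewrite (bigD1 (Ordinal lt_last)) //= eqxx andbT big1 ?addn0 // => c.
by rewrite -val_eqE /= eq_sym => /negbTE ->; rewrite andbF.
Qed.

(** * Standardization of words *)

(* Ties are broken from left to right between even letters and from right to
   left between odd ones. *)
Definition pos_lt (w : seq nat) (i j : nat) : bool :=
  (i != j) && step (j < i)%N (nth 0%N w i) (nth 0%N w j).

Lemma pos_lt_irr w i : pos_lt w i i = false.
Proof. by rewrite /pos_lt eqxx. Qed.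

Lemma step_lt_eq e b c : step e b c = (b < c)%N || ((b == c) && (odd c == e)).
Proof. by rewrite /step; case: (_ == e) => /=; lia. Qed.

Lemma pos_lt_trans w i j k : pos_lt w i j -> pos_lt w j k -> pos_lt w i k.
Proof.
rewrite /pos_lt !step_lt_eq; set x := nth _ w i; set y := nth _ w j.
set z := nth _ w k => /andP[ij /orP[xy|/andP[/eqP <- xj]]].
  case/andP=> jk yz; have {yz} lt_xz : (x < z)%N.
    by case/orP: yz => [|/andP[/eqP <-]] //; apply: ltn_trans.
  by rewrite lt_xz andbT; apply: contraTneq lt_xz; rewrite /x => ->; rewrite ltnn.
case/andP=> jk /orP[xz|/andP[/eqP <- xk]].
  by rewrite xz andbT; apply: contraTneq xz; rewrite /x => ->; rewrite ltnn.
rewrite ltnn eqxx /=; move: xj xk; case: (odd x); lia.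
Qed.

Lemma pos_lt_total w i j : i != j -> pos_lt w i j || pos_lt w j i.
Proof.
move=> ij; rewrite /pos_lt !step_lt_eq ij (eq_sym j) ij /=.
case: ltngtP => //= ->; case: (odd _); lia.
Qed.

Lemma pos_lt_asym w i j : pos_lt w i j -> pos_lt w j i = false.
Proof.
by move=> ij; apply/negP => /(pos_lt_trans ij); rewrite pos_lt_irr.
Qed.

(** Ties depend only on the relative order of positions, which a shift preserves. *)
Lemma pos_lt_factor w i m a b : (a < m)%N -> (b < m)%N ->
  pos_lt (take m (drop i w)) a b = pos_lt w (i + a) (i + b).
Proof.
by move=> am bm; rewrite /pos_lt !nth_take // !nth_drop eqn_add2l ltn_add2l.
Qed.

Definition standardizes (n : nat) (p : 'S_n) (w : seq nat) : bool :=
  [forall i, forall j, (p i < p j)%N == pos_lt w i j].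

Lemma standardizesP n (p : 'S_n) w :
  reflect (forall i j : 'I_n, (p i < p j)%N = pos_lt w i j) (standardizes p w).
Proof.
apply: (iffP forallP) => [H i j|H i]; first exact: eqP (forallP (H i) j).
by apply/forallP => j; apply/eqP.
Qed.

Lemma ord_countE n (p : 'S_n) (i : 'I_n) : #|[set j | p j < p i]%N| = p i :> nat.
Proof.
rewrite -sum1_card (reindex_inj (@perm_inj _ (p^-1)%g)) /=.
under eq_bigl => k do rewrite inE permKV.
by rewrite -(big_ord_widen _ (fun=> 1%N) (ltnW (ltn_ord (p i)))) sum1_card card_ord.
Qed.

Lemma standardizes_uniq n (p q : 'S_n) w :
  standardizes p w -> standardizes q w -> p = q.
Proof.
move=> /standardizesP pw /standardizesP qw; apply/permP => i; apply: val_inj.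
rewrite /= -ord_countE -[RHS]ord_countE; apply: eq_card => j.
by rewrite !inE pw qw.
Qed.

(** Send each position to the number of positions before it in [pos_lt]. Transitivity makes this
    strictly monotone, and totality then makes it injective. *)
Lemma standardizes_ex n w : exists p : 'S_n, standardizes p w.
Proof.
pose before (i : 'I_n) := [set j : 'I_n | pos_lt w j i].
have rank_lt (i : 'I_n) : (#|before i| < n)%N.
  rewrite -[X in (_ < X)%N]card_ord -[X in (_ < X)%N]cardsT.
  apply: proper_card; apply/fintype.properP; split; first exact: finset.subsetT.
  by exists i; rewrite ?inE ?pos_lt_irr.
have mono (i j : 'I_n) : pos_lt w i j -> (#|before i| < #|before j|)%N.
  move=> ij; apply: proper_card; apply/fintype.properP; split.
    by apply/fintype.subsetP => k; rewrite !inE => /pos_lt_trans; apply.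
  by exists i; rewrite inE ?pos_lt_irr.
pose rank i := Ordinal (rank_lt i).
have rank_inj : injective rank.
  move=> i j /(congr1 val) /= eq_ij; apply/val_inj/eqP/contraT => ne_ij.
  by case/orP: (pos_lt_total w ne_ij) => /mono; rewrite eq_ij ltnn.
exists (perm rank_inj); apply/standardizesP => i j; rewrite !permE /=.
have [->|ne_ij] := eqVneq i j; first by rewrite ltnn pos_lt_irr.
case/orP: (pos_lt_total w ne_ij) => ij; first by rewrite ij mono.
by rewrite (pos_lt_asym ij) ltnNge ltnW ?mono.
Qed.

Lemma sum_standardizes (V : nmodType) n w (f : 'S_n -> V) (x : V) :
  (forall p, standardizes p w -> f p = x) ->
  \sum_(p | standardizes p w) f p = x.
Proof.
move=> fx; have [p pw] := standardizes_ex n w.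
rewrite (big_pred1 p) ?fx // => q; apply/idP/eqP => [qw|->//].
exact: standardizes_uniq qw pw.
Qed.

(** * Left peaks, and the words with a given standardization *)

(** The guard makes the step into position 0 a rise, in agreement with the virtual letter 0. *)
Definition descent (n : nat) (q : 'S_n) (r : nat) : bool :=
  (0 < r)%N && (nth 0 (one_line q) r < nth 0 (one_line q) r.-1)%N.

Lemma nth_one_line n (q : 'S_n) (i : 'I_n) : nth 0%N (one_line q) i = (q i).+1.
Proof. by rewrite (nth_map i) ?size_enum_ord // nth_ord_enum. Qed.

Lemma size_one_line n (q : 'S_n) : size (one_line q) = n.
Proof. by rewrite size_map size_enum_ord. Qed.

(** Distinct values make every later non-descent a rise, and the virtual rise accounts for a left
    peak at the first position. The last position is never a left peak, hence the shorter sum. *)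
Lemma lpk_rise_falls n (q : 'S_n) : lpk q = rise_falls (descent q) n.
Proof.
rewrite /lpk /rise_falls -sum1_card big_mkcond /=.
case: n q => [|n] q; first by rewrite !big_ord0.
rewrite big_ord_recr /= inE /left_peak ltnn addn0; apply: eq_bigr => i _.
rewrite inE /= ltnS ltn_ord /= /descent.
congr nat_of_bool; rewrite andbC; congr (_ && _).
case: posnP => [->|i_gt0] //=.
have lt_i : (i < n.+1)%N by rewrite ltnW ?ltnS.
have lt_i1 : (i.-1 < n.+1)%N by apply: leq_ltn_trans (leq_pred i) lt_i.
have : nth 0%N (one_line q) i.-1 != nth 0%N (one_line q) i.
  rewrite (nth_one_line q (Ordinal lt_i1)) (nth_one_line q (Ordinal lt_i)).
  rewrite eqSS; apply/negP => /eqP/val_inj/perm_inj/(congr1 val) /=; lia.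
by case: ltngtP.
Qed.

Definition sorted_letters (n : nat) (p : 'S_n) (w : seq nat) : seq nat :=
  [seq nth 0%N w ((p^-1)%g r) | r <- enum 'I_n].

Lemma size_sorted_letters n (p : 'S_n) w : size (sorted_letters p w) = n.
Proof. by rewrite size_map size_enum_ord. Qed.

Lemma nth_sorted_letters n (p : 'S_n) w (r : 'I_n) :
  nth 0%N (sorted_letters p w) r = nth 0%N w ((p^-1)%g r).
Proof. by rewrite (nth_map r) ?size_enum_ord // nth_ord_enum. Qed.

Lemma perm_sorted_letters K n (p : 'S_n) :
  perm_eq [seq sorted_letters p w | w <- words K n] (words K n).
Proof.
have inj : {in words K n &, injective (sorted_letters p)}.
  move=> v w /size_words sv /size_words sw eq_vw.
  apply: (@eq_from_nth _ 0%N) => [|i]; rewrite sv // => lt_in.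
  have := congr1 (fun s => nth 0%N s (p (Ordinal lt_in))) eq_vw.
  by rewrite !nth_sorted_letters permK.
have uniq_im : uniq [seq sorted_letters p w | w <- words K n].
  by rewrite map_inj_in_uniq ?uniq_words.
apply: uniq_perm => //; first exact: uniq_words.
have sub : {subset [seq sorted_letters p w | w <- words K n] <= words K n}.
  move=> _ /mapP[w wn ->]; rewrite mem_words size_sorted_letters eqxx /=.
  apply/allP => _ /mapP[r _ ->]; move: wn; rewrite mem_words => /andP[/eqP sw].
  by move=> /allP; apply; rewrite mem_nth // sw.
by have [|] := uniq_min_size uniq_im sub; rewrite ?size_map.
Qed.

(** Both sides say that the positions, listed by rank, increase for [pos_lt]: a descent of the
    inverse of [p] means that the next position lies further left, which is the tie-breaking bit of
    [pos_lt]. By transitivity consecutive ranks suffice. *)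
Lemma standardizes_chain n (p : 'S_n) w :
  standardizes p w = chain (descent (p^-1)%g) (sorted_letters p w).
Proof.
set q := (p^-1)%g.
have stepE r (lt_r : (r < n)%N) (lt_Sr : (r.+1 < n)%N) :
    step (descent q r.+1) (nth 0 (0%N :: sorted_letters p w) r.+1)%N
      (nth 0 (sorted_letters p w) r.+1)%N =
    pos_lt w (q (Ordinal lt_r)) (q (Ordinal lt_Sr)).
  rewrite /descent -[r.+1.-1]/(val (Ordinal lt_r)).
  rewrite -[r.+1]/(val (Ordinal lt_Sr)) !nth_one_line ltnS.
  rewrite nth_sorted_letters /= (nth_sorted_letters p w (Ordinal lt_r)) -/q.
  rewrite /pos_lt; case: eqVneq => //.
  by move/val_inj/perm_inj/(congr1 val)/eqP;
  rewrite /= -[_ == _]/(r == r.+1) ltn_eqF.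
apply/standardizesP/allP => [pw [|r]|ch i j].
- by rewrite step_lt_eq; case: (nth 0%N (sorted_letters p w) 0%N).
- rewrite mem_iota size_sorted_letters add0n /= => lt_Sr.
  have lt_r := ltnW lt_Sr.
  by rewrite (stepE _ lt_r lt_Sr) -pw !permKV /=.
have consec r (lt_r : (r < n)%N) (lt_Sr : (r.+1 < n)%N) :
    pos_lt w (q (Ordinal lt_r)) (q (Ordinal lt_Sr)).
  by rewrite -stepE; apply: ch; rewrite mem_iota size_sorted_letters add0n.
have incr (a b : 'I_n) : (a < b)%N -> pos_lt w (q a) (q b).
  case: b => b lt_b; elim: b lt_b => // b IHb lt_Sb; have lt_b := ltnW lt_Sb.
  rewrite /= ltnS leq_eqVlt => /orP[/eqP Eab|lt_ab].
    by have -> : a = Ordinal lt_b; [apply: val_inj | apply: consec].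
  exact: pos_lt_trans (IHb lt_b lt_ab) (consec _ _ _).
rewrite -{2}[i](permK p) -{2}[j](permK p) -/q.
have [lt_ij|lt_ji|/val_inj->] := ltngtP (p i) (p j).
- by rewrite incr.
- by rewrite (pos_lt_asym (incr _ _ lt_ji)).
- by rewrite pos_lt_irr.
Qed.

(** By the chain series each [p] contributes [h p] once for every word that it standardizes.
    Exchanging the sums leaves exactly one permutation for each word. *)
Lemma sum_ilpk_series (A : comNzRingType) n (h : 'S_n -> A) (H : seq nat -> A) :
  (forall p w, size w = n -> standardizes p w -> h p = H w) ->
  (1 - fps_X A)^-1 *
    (\sum_p fps_const (h p) *
       (4%:R * fps_X A / (1 + fps_X A) ^+ 2) ^+ ilpk p) *
    ((1 + fps_X A) / (1 - fps_X A)) ^+ n =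
  Fps (fun i => \sum_(w <- words i.*2.+1 n) H w).
Proof.
move=> hH; apply: fpsP => i; rewrite mulr_sumr mulr_suml fps_sumE [RHS]/=.
transitivity (\sum_p \sum_(w <- words i.*2.+1 n | standardizes p w) h p).
  apply: eq_bigr => p _.
  rewrite mulrCA -[_ * _ * _ ^+ n]mulrA fps_const_mulE
    -[_ * _ * _ ^+ n]mulrA /ilpk lpk_rise_falls.
  rewrite chain_count_series //= sum_chain_count // big_const_seq.
  rewrite iter_addr_0 mulr_natr; congr (_ *+ _).
  rewrite -(perm_big _ (perm_sorted_letters _ p)) big_map -sum1_count.
  rewrite [RHS]big_mkcond /=; apply: eq_bigr => w _.
  by rewrite standardizes_chain; case: chain.
rewrite (exchange_big_dep xpredT) //=; apply: eq_big_seq => w /size_words sw.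
by apply: sum_standardizes => p; apply: hH.
Qed.


(** * Pattern occurrences read off a word *)

Lemma std_one_lineE m (q : 'S_m) v : size v = m ->
  (std v == one_line q) =
  [forall a : 'I_m, #|[set b : 'I_m | nth 0 v b < nth 0 v a]%N| == q a].
Proof.
move=> sv.
have nth_std (a : 'I_m) :
    nth 0%N (std v) a = #|[set b : 'I_m | nth 0 v b < nth 0 v a]%N|.+1.
  rewrite (nth_map 0%N) ?sv //; congr _.+1.
  rewrite -sum1_count (big_nth 0%N) sv big_mkord -sum1_card.
  by apply: eq_bigl => b; rewrite inE.
apply/eqP/forallP => [std_v a|rank_q].
  by rewrite -eqSS -nth_std std_v nth_one_line.
apply: (@eq_from_nth _ 0%N) => [|i]; rewrite size_map sv ?size_one_line // => im.
by rewrite (nth_std (Ordinal im)) (nth_one_line q (Ordinal im)) (eqP (rank_q _)).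
Qed.

(** The factors of [p] and of [w] at the same place are ordered alike, so they have the same
    standardization. *)
Lemma occurrence_standardizes n m (p : 'S_n) (q : 'S_m) w i :
  standardizes p w ->
  occurrence p q i = (i + m <= n)%N && standardizes q (take m (drop i w)).
Proof.
move=> /standardizesP pw; rewrite /occurrence.
have [le_im|//] := leqP (i + m)%N n.
set v := take m (drop i (one_line p)); set w' := take m (drop i w).
have sv : size v = m.
  by rewrite size_takel // size_drop size_one_line leq_subRL //
    (leq_trans _ le_im) // leq_addr.
have lt_vw (a b : 'I_m) : (nth 0 v a < nth 0 v b)%N = pos_lt w' a b.
  have lt_n (c : 'I_m) : (i + c < n)%N by rewrite (leq_trans _ le_im) // ltn_add2l.
  rewrite pos_lt_factor // !nth_take // !nth_drop.
  rewrite (nth_one_line p (Ordinal (lt_n a))) (nth_one_line p (Ordinal (lt_n b))).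
  by rewrite ltnS pw.
rewrite std_one_lineE //=.
have rankE (r : 'S_m) (a : 'I_m) : standardizes r w' ->
    #|[set b : 'I_m | nth 0 v b < nth 0 v a]%N| = r a.
  move=> /standardizesP rw'; rewrite -ord_countE; apply: eq_card => b.
  by rewrite !inE lt_vw rw'.
apply/forallP/idP => [rank_q|qw' a]; last by rewrite (rankE q).
have [r rw'] := standardizes_ex m w'.
suff -> : q = r by [].
by apply/permP => a; apply: val_inj; rewrite /= -(rankE r) // (eqP (rank_q a)).
Qed.

(** * Generating functions of subsets by size *)

Section SubsetSums.
Variables (A : comNzRingType) (y : A).

(** With y = s - 1 the right-hand side is a power of s: each occurrence is either marked, with
    weight s - 1, or left unmarked. *)
Lemma sum_subsets (T : finType) (S : {set T}) :
  \sum_(c : {set T} | c \subset S) y ^+ #|c| = (1 + y) ^+ #|S|.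
Proof.
rewrite exprDn.
rewrite (partition_big (fun c : {set T} => inord #|c| : 'I_#|S|.+1) xpredT) //=.
apply: eq_bigr => i _; rewrite expr1n mul1r -cards_draws -sumr_const.
apply: eq_big => c; last first.
  by move=> /andP[cS /eqP <-]; rewrite inordK // ltnS subset_leq_card.
rewrite inE; apply: andb_id2l => cS.
by rewrite -val_eqE /= inordK // ltnS subset_leq_card.
Qed.

(** A subset is the pair of its traces on [S1] and [S2]; [Q] sees only the first trace, and the
    second is free. *)
Lemma sum_subsetsU (T : finType) (S1 S2 : {set T}) (Q : pred {set T}) :
    S1 :&: S2 = finset.set0 ->
    (forall c1 c2 : {set T}, c1 \subset S1 -> c2 \subset S2 ->
       Q (c1 :|: c2) = Q c1) ->
  \sum_(c : {set T} | (c \subset S1 :|: S2) && Q c) y ^+ #|c| =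
  (\sum_(c : {set T} | (c \subset S1) && Q c) y ^+ #|c|) * (1 + y) ^+ #|S2|.
Proof.
move=> S12 QU; rewrite -sum_subsets big_distrlr /= pair_big /=.
have meetU (c1 c2 : {set T}) : c1 \subset S1 -> c2 \subset S2 ->
    ((c1 :|: c2) :&: S1 = c1) /\ ((c1 :|: c2) :&: S2 = c2).
  move=> c1S c2S; rewrite !finset.setIUl (finset.setIidPl c1S) (finset.setIidPl c2S).
  have -> : c2 :&: S1 = finset.set0.
    by apply/eqP; rewrite -finset.subset0 -S12 finset.setIC finset.setIS.
  have -> : c1 :&: S2 = finset.set0.
    by apply/eqP; rewrite -finset.subset0 -S12 finset.setSI.
  by rewrite finset.setU0 finset.set0U.
rewrite [RHS](reindex_onto (fun c : {set T} => (c :&: S1, c :&: S2))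
   (fun c => c.1 :|: c.2)) /=; last first.
  by move=> [c1 c2] /= /andP[/andP[c1S _] c2S]; case: (meetU c1 c2) => // -> ->.
apply: eq_big => c; last first.
  case/andP=> cS _; rewrite -exprD -cardsUI.
  rewrite finset.setIACA finset.setIid S12 finset.setI0 cards0 addn0.
  by rewrite -finset.setIUr (finset.setIidPl cS).
rewrite -finset.setIUr !finset.subsetIr !andbT /= andbC.
have -> : (c :&: (S1 :|: S2) == c) = (c \subset S1 :|: S2).
  by apply/eqP/finset.setIidPl.
rewrite [RHS]andbC; case: (boolP (c \subset _)) => cS; last by rewrite andbF.
rewrite andbT /= -[c in LHS](finset.setIidPl cS) finset.setIUr.
by rewrite QU ?finset.subsetIr.
Qed.

Lemma sum_subsets_imset (T T' : finType) (f : T -> T') (S : {set T})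
    (Q : pred {set T}) (Q' : pred {set T'}) : {in S &, injective f} ->
    (forall c : {set T}, c \subset S -> Q c = Q' (f @: c)) ->
  \sum_(c : {set T} | (c \subset S) && Q c) y ^+ #|c| =
  \sum_(c : {set T'} | (c \subset f @: S) && Q' c) y ^+ #|c|.
Proof.
move=> f_inj QQ'.
rewrite [RHS](reindex_onto (fun c : {set T} => f @: c)
  (fun c' => S :&: f @^-1: c')) /=; last first.
  move=> c' /andP[/fintype.subsetP c'S _]; apply/setP => z; apply/imsetP/idP.
    by case=> x; rewrite !inE => /andP[_ fx ->].
  move=> zc'; have /imsetP[x xS Ez] := c'S _ zc'.
  by exists x; rewrite // !inE xS -Ez.
have pre_im (c : {set T}) : (S :&: f @^-1: (f @: c) == c) = (c \subset S).
  apply/eqP/idP => [<-|cS]; first exact: finset.subsetIl.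
  apply/setP => x; rewrite !inE; apply/andP/idP => [[xS /imsetP[x' x'c]]|xc].
    by move/f_inj => -> //; apply: (fintype.subsetP cS).
  by split; [apply: (fintype.subsetP cS) | apply: imset_f].
apply: eq_big => c.
  rewrite pre_im; case: (boolP (c \subset S)) => cS; last by rewrite andbF.
  by rewrite andbT finset.imsetS // QQ'.
case/andP=> cS _; rewrite card_in_imset // => a b ac bc.
by apply: f_inj; apply: (fintype.subsetP cS).
Qed.

End SubsetSums.

(** * Cuts of a word crossed by marks *)

Section Gaps.
Variables (T : finType) (st en : T -> nat).

(** A mark is given by its end cuts [st] and [en]. Cut [j] lies after the first [j] letters and is
    crossed when it is strictly inside the mark. *)
Definition crossed (c : {set T}) (j : nat) : bool :=
  [exists a in c, (st a < j < en a)%N].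

Definition joined (k : nat) (c : {set T}) : bool :=
  [forall j : 'I_k, (0 < j)%N ==> crossed c j].

Lemma crossedP (c : {set T}) j :
  reflect (exists2 a, a \in c & (st a < j < en a)%N) (crossed c j).
Proof. exact: exists_inP. Qed.

Lemma joinedP k (c : {set T}) :
  reflect (forall j, (0 < j < k)%N -> crossed c j) (joined k c).
Proof.
apply: (iffP forallP) => [ck j /andP[j_gt0 lt_jk]|ck j].
  by have /implyP := ck (Ordinal lt_jk); apply.
by apply/implyP => j_gt0; apply: ck; rewrite j_gt0 ltn_ord.
Qed.

(** The index [k0] is chosen so that [k0.+1] is the least positive uncrossed cut, which exists
    because cut [n] is uncrossed. *)
Lemma first_gap n (c : {set T}) : (0 < n)%N -> ~~ crossed c n ->
  exists k0 : 'I_n, forall k : 'I_n,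
    (joined k.+1 c && ~~ crossed c k.+1) = (k == k0).
Proof.
case: n => // n _ cn; have ex_gap : exists m, ~~ crossed c m.+1 by exists n.
case: (ex_minnP ex_gap) => m cm min_m; have le_mn := min_m _ cn.
have lt_mn : (m < n.+1)%N by [].
exists (Ordinal lt_mn) => k; apply/andP/eqP => [[/joinedP jk ck]|->].
  apply/val_inj/eqP; rewrite /= eqn_leq min_m // andbT leqNgt.
  by apply: contra cm => lt_mk; apply: jk.
split=> //; apply/joinedP => -[//|j] /=; rewrite ltnS => lt_jm.
by apply: contraLR lt_jm => /min_m; rewrite -leqNgt.
Qed.

End Gaps.

Lemma joined_imset (T T' : finType) (st en : T -> nat) (st' en' : T' -> nat)
    (f : T -> T') k (c : {set T}) :
    {in c, forall a, st' (f a) = st a /\ en' (f a) = en a} ->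
  joined st en k c = joined st' en' k (f @: c).
Proof.
move=> fE; apply: eq_forallb => j; congr (_ ==> _).
apply/crossedP/crossedP => [[a ac aj]|[_ /imsetP[a ac ->]]].
  by exists (f a); rewrite ?imset_f //; case: (fE a ac) => -> ->.
by case: (fE a ac) => -> -> aj; exists a.
Qed.

(** * The cluster method for words *)

Section WordClusters.
Variable Gamma : set permutation.

Definition has_pattern (m : nat) (v : seq nat) : bool :=
  `[< exists q : 'S_m, Gamma (Tagged (fun m => 'S_m) q) /\ standardizes q v >].

(** Only the end cuts are recorded, since the pattern is the standardization of the factor between
    them. The first condition demands length at least 2. *)
Definition hit (w : seq nat) (i j : nat) : bool :=
  [&& (i.+1 < j)%N, (j <= size w)%N &
      has_pattern (j - i) (take (j - i) (drop i w))].

Lemma hit_take w k i j : hit (take k w) i j = hit w i j && (j <= k)%N.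
Proof.
rewrite /hit size_take_min leq_min.
have [le_jk|_] := leqP j k; last by rewrite !andbF.
rewrite andbT; case: (ltnP i.+1 j) => //= lt_ij; congr (_ && has_pattern _ _).
have eq_j : (j - i + i = j)%N by rewrite subnK // ltnW // ltnW.
by rewrite !take_drop eq_j take_takel.
Qed.

Lemma hit_drop w k i j : (k <= size w)%N ->
  hit (drop k w) i j = hit w (i + k) (j + k).
Proof.
move=> le_kw; rewrite /hit size_drop drop_drop subnDr -addSn ltn_add2r.
by congr [&& _, _ & _]; rewrite leq_subRL // addnC.
Qed.

(** The bound [N] lets one finite type hold the hits of a word and of all its factors. *)
Definition hits (N : nat) (w : seq nat) : {set 'I_N.+1 * 'I_N.+1} :=
  [set a : 'I_N.+1 * 'I_N.+1 | hit w a.1 a.2].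

Notation hst := (fun a => nat_of_ord a.1).
Notation hen := (fun a => nat_of_ord a.2).

Variables (A : comNzRingType) (y : A).

(** A single letter has no inner cut, and the empty set gives it weight 1. From length 2 on, the
    sets counted are the clusters. *)
Definition block_weight (N : nat) (w : seq nat) : A :=
  \sum_(c : {set 'I_N.+1 * 'I_N.+1} |
        (c \subset hits N w) && joined hst hen (size w) c) y ^+ #|c|.

Section Transport.
Variables (w : seq nat) (N : nat) (T : finType) (st en : T -> nat).
Variable S : {set T}.
Hypothesis le_wN : (size w <= N)%N.
Hypothesis S_inj : {in S &, forall a b, st a = st b -> en a = en b -> a = b}.
Hypothesis S_hit : forall a, a \in S -> hit w (st a) (en a).
Hypothesis hit_S : forall i j, hit w i j ->
  exists2 a, a \in S & st a = i /\ en a = j.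

Let f (a : T) : 'I_N.+1 * 'I_N.+1 := (inord (st a), inord (en a)).

Let fE a : a \in S -> (f a).1 = st a :> nat /\ (f a).2 = en a :> nat.
Proof.
move=> /S_hit /and3P[lt_ij le_j _] /=; rewrite !inordK //; lia.
Qed.

Let f_inj : {in S &, injective f}.
Proof.
move=> a b aS bS eq_ab; have [Ea1 Ea2] := fE aS; have [Eb1 Eb2] := fE bS.
by apply: S_inj => //; rewrite -?Ea1 -?Ea2 eq_ab.
Qed.

Let imS : f @: S = hits N w.
Proof.
apply/setP => -[i j]; rewrite inE /=; apply/imsetP/idP => [[a aS Ea]|ij].
  by have [] := fE aS; rewrite -Ea /= => -> ->; apply: S_hit.
have [a aS [Ei Ej]] := hit_S ij; exists a => //.
by rewrite /f Ei Ej !inord_val.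
Qed.

Lemma card_hits : #|hits N w| = #|S|.
Proof. by rewrite -imS card_in_imset. Qed.

Lemma block_weight_transport :
  \sum_(c : {set T} | (c \subset S) && joined st en (size w) c) y ^+ #|c| =
  block_weight N w.
Proof.
rewrite /block_weight -imS; apply: sum_subsets_imset => // c cS.
by apply: joined_imset => a /(fintype.subsetP cS) /fE.
Qed.

End Transport.


Lemma card_hits_size N w : (size w <= N)%N -> #|hits N w| = #|hits (size w) w|.
Proof.
move=> le_wN; apply: (@card_hits w N _ hst hen) => //.
- by move=> [a1 a2] [b1 b2] _ _ /= /val_inj -> /val_inj ->.
- by move=> a; rewrite inE.
move=> i j ij; have /and3P[lt_ij le_j _] := ij.
have lt_i : (i < (size w).+1)%N by lia.
by exists (Ordinal lt_i, Ordinal (le_j : j < (size w).+1)%N); rewrite ?inE.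
Qed.

Lemma block_weight_size N w : (size w <= N)%N ->
  block_weight N w = block_weight (size w) w.
Proof.
move=> le_wN; apply/esym/block_weight_transport => //.
- by move=> [a1 a2] [b1 b2] _ _ /= /val_inj -> /val_inj ->.
- by move=> a; rewrite inE.
move=> i j ij; have /and3P[lt_ij le_j _] := ij.
have lt_i : (i < (size w).+1)%N by lia.
by exists (Ordinal lt_i, Ordinal (le_j : j < (size w).+1)%N); rewrite ?inE.
Qed.

Lemma card_hits_drop N w k : (k <= size w <= N)%N ->
  #|[set a in hits N w | (k <= a.1)%N]| = #|hits N (drop k w)|.
Proof.
case/andP=> le_kw le_wN; apply/esym.
apply: (@card_hits _ N ('I_N.+1 * 'I_N.+1)%type
  (fun a => a.1 - k)%N (fun a => a.2 - k)%N).
- by rewrite size_drop; lia.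
- move=> [a1 a2] [b1 b2]; rewrite !inE /= => /andP[/and3P[lt_a _ _] ka].
  move=> /andP[/and3P[lt_b _ _] kb] E1 E2.
  by congr (_, _); apply/val_inj => /=; lia.
- move=> a; rewrite !inE => /andP[ha ka]; have /and3P[lt_a _ _] := ha.
  by rewrite hit_drop // !subnK // (leq_trans ka) // ltnW // ltnW.
move=> i j; rewrite hit_drop // => ij; have /and3P[lt_ij le_j _] := ij.
have lt_i : (i + k < N.+1)%N by lia.
have lt_j : (j + k < N.+1)%N by lia.
exists (Ordinal lt_i, Ordinal lt_j); rewrite ?inE /= ?ij ?leq_addl //.
by rewrite !addnK.
Qed.

(** Expand the power over sets of marked hits and sort these by their first uncrossed cut. A block
    stands before it; after it any set of hits is allowed. *)
Lemma hits_first_block N w : (0 < size w <= N)%N ->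
  (1 + y) ^+ #|hits N w| =
  \sum_(k < size w)
    block_weight N (take k.+1 w) * (1 + y) ^+ #|hits N (drop k.+1 w)|.
Proof.
case/andP=> w_gt0 le_wN; rewrite -sum_subsets.
(* No hit reaches beyond the end of [w], so a first uncrossed cut always exists. *)
have not_crossed_end (c : {set 'I_N.+1 * 'I_N.+1}) :
    c \subset hits N w -> ~~ crossed hst hen c (size w).
  move=> /fintype.subsetP cw; apply/crossedP => -[a /cw].
  by rewrite inE => /and3P[_ le_aw _]; rewrite (ltnNge (size w)) le_aw andbF.
transitivity (\sum_(c : {set 'I_N.+1 * 'I_N.+1} | c \subset hits N w)
   \sum_(k < size w | joined hst hen k.+1 c && ~~ crossed hst hen c k.+1)
      y ^+ #|c|).
  apply: eq_bigr => c /not_crossed_end /(first_gap w_gt0) [k0 k0E].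
  by rewrite (big_pred1 k0).
rewrite (exchange_big_dep xpredT) //=; apply: eq_bigr => k _.
(* When cut [k.+1] is not crossed, each mark ends at or before it, or starts at or after it. *)
pose S1 := [set a in hits N w | (a.2 <= k.+1)%N].
pose S2 := [set a in hits N w | (k.+1 <= a.1)%N].
transitivity (\sum_(c : {set 'I_N.+1 * 'I_N.+1} |
    (c \subset S1 :|: S2) && joined hst hen k.+1 c) y ^+ #|c|).
  apply: eq_bigl => c; rewrite [joined _ _ _ _ && _]andbC andbA.
  congr (_ && _); apply/andP/fintype.subsetP => [[/fintype.subsetP cw ck] a ac|c12].
    have aw := cw a ac; rewrite !inE; move: aw; rewrite inE => -> /=.
    have [//|lt_ka] := leqP _ k.+1; rewrite leqNgt; apply: contra ck => lt_ak.
    by apply/crossedP; exists a; rewrite ?lt_ak.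
  split; first by apply/fintype.subsetP => a /c12; rewrite !inE => /orP[] /andP[].
  by apply/crossedP => -[[a1 a2] /c12]; rewrite !inE /= => /orP[] /andP[_]; lia.
have S12 : S1 :&: S2 = finset.set0.
  apply/setP => -[a1 a2]; rewrite !inE /=; apply/negP => /andP[/andP[]].
  by case/and3P=> lt_a _ _ le_a2 /andP[_ le_a1]; lia.
rewrite sum_subsetsU // => [|c1 c2 c1S c2S]; last first.
  apply/joinedP/joinedP => cj j lt_j; have /crossedP[[a1 a2] ac aj] := cj j lt_j.
    move: ac; rewrite inE => /orP[ac|/(fintype.subsetP c2S)].
      by apply/crossedP; exists (a1, a2).
    by move: aj; rewrite !inE /= => + /andP[_]; lia.
  by apply/crossedP; exists (a1, a2); rewrite // inE ac.
rewrite card_hits_drop ?le_wN ?andbT // /block_weight.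
rewrite size_takel //; congr (_ * _); apply: eq_bigl => c.
suff -> : hits N (take k.+1 w) = S1 by [].
by apply/setP => a; rewrite !inE hit_take.
Qed.

Definition word_series (K : nat) : fps A :=
  Fps (fun n => \sum_(w <- words K n) (1 + y) ^+ #|hits (size w) w|).

(** The empty word has [block_weight] 1 but is no block. The constant term 0 is what the geometric
    expansion requires. *)
Definition block_series (K : nat) : fps A :=
  Fps (fun n => if n is 0 then 0 else
    \sum_(w <- words K n) block_weight (size w) w).

Lemma hits_short N w : (size w < 2)%N -> hits N w = finset.set0.
Proof.
move=> lt_w2; apply/setP => a; rewrite !inE; apply/negP => /and3P[]; lia.
Qed.

Lemma word_series_rec K : word_series K = 1 + block_series K * word_series K.
Proof.
apply: fpsP => -[|n]; rewrite fps_addE fps_oneE fps_mulE big_ord_recl mul0r add0r.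
  by rewrite big_ord0 addr0 /= big_seq1 hits_short // cards0 expr0.
rewrite add0r [LHS]/=.
transitivity (\sum_(w <- words K n.+1) \sum_(k < n.+1)
   block_weight (size (take k.+1 w)) (take k.+1 w) *
   (1 + y) ^+ #|hits (size (drop k.+1 w)) (drop k.+1 w)|).
  apply: eq_big_seq => w /(@size_words K n.+1) sw.
  rewrite hits_first_block ?sw ?leqnn //; apply: eq_bigr => k _.
  rewrite block_weight_size ?card_hits_size ?size_drop ?size_takel ?sw //.
  exact: leq_subr.
rewrite exchange_big /=; apply: eq_bigr => k _.
rewrite subSS big_distrlr /=.
have En : (k.+1 + (n - k) = n.+1)%N by have := ltn_ord k; lia.
transitivity (\sum_(w <- words K (k.+1 + (n - k)))
   block_weight (size (take k.+1 w)) (take k.+1 w) *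
   (1 + y) ^+ #|hits (size (drop k.+1 w)) (drop k.+1 w)|); first by rewrite En.
rewrite big_words_cat; apply: eq_big_seq => v /(@size_words K k.+1) sv.
apply: eq_bigr => u _.
by rewrite -sv take_size_cat // drop_size_cat.
Qed.

(** * From marked occurrences in a permutation to hits in a word *)

Section MarkedOccurrences.
Variables (n : nat) (p : 'S_n) (w : seq nat).
Hypothesis hGamma : forall (m : nat) (q : 'S_m),
  Gamma (Tagged (fun m => 'S_m) q) -> (2 <= m)%N.
Hypothesis sw : size w = n.
Hypothesis pw : standardizes p w.

Let ends (a : mark n) : nat := (mark_pos a + mark_len a)%N.

Let markedP (a : mark n) : (a \in marked_occurrences Gamma p) =
  [&& mark_pat a \in Gamma, (ends a <= n)%N &
      standardizes (tagged a.2) (take (mark_len a) (drop (mark_pos a) w))].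
Proof. by rewrite inE (occurrence_standardizes _ _ pw). Qed.

(** Equal end cuts give the same factor, and this has only one standardization, so the patterns
    agree. *)
Let marked_inj : {in marked_occurrences Gamma p &, forall a b,
  mark_pos a = mark_pos b -> ends a = ends b -> a = b}.
Proof.
move=> [i [m q]] [j [m' q']]; rewrite !markedP => /and3P[_ _ qw] /and3P[_ _ qw'].
rewrite /ends /= => Eij Emm; rewrite /mark_pos /mark_len /= in Eij Emm qw qw'.
move/val_inj: Eij Emm qw' => <- /addnI/val_inj Em; case: m' / Em q' => q' qw'.
by rewrite (standardizes_uniq qw qw').
Qed.

Let marked_hit (a : mark n) :
  a \in marked_occurrences Gamma p -> hit w (mark_pos a) (ends a).
Proof.
rewrite markedP => /and3P[aG le_a qw]; rewrite /hit sw le_a /ends addKn /=.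
move: aG; rewrite inE => aG; have len_ge2 : (1 < mark_len a)%N := hGamma aG.
apply/andP; split; first by move: len_ge2; rewrite /mark_len; lia.
by apply/asboolP; exists (tagged a.2).
Qed.

Let hit_marked i j : hit w i j ->
  exists2 a : mark n, a \in marked_occurrences Gamma p &
    mark_pos a = i /\ ends a = j.
Proof.
case/and3P=> lt_ij; rewrite sw => le_jn /asboolP[q [qG qw]].
have lt_i : (i < n.+1)%N by lia.
have lt_m : (j - i < n.+1)%N by lia.
have le_ij : (i <= j)%N by lia.
exists ((Ordinal lt_i,
  Tagged (fun m : 'I_n.+1 => 'S_m) (q : 'S_(Ordinal lt_m))) : mark n).
  rewrite markedP /ends /mark_pos /mark_len /= subnKC // le_jn qw !andbT.
  exact: mem_set.
by rewrite /ends /mark_pos /mark_len /= subnKC.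
Qed.

Lemma occ_hits : occ Gamma p = #|hits (size w) w|.
Proof. exact/esym/(@card_hits _ _ _ (@mark_pos n) ends). Qed.

Lemma cluster_block_weight : (2 <= n)%N ->
  \sum_(c : {set mark n} | is_cluster Gamma p c) y ^+ #|c| =
  block_weight (size w) w.
Proof.
move=> n_ge2.
rewrite -(@block_weight_transport w _ _ (@mark_pos n) ends
            (marked_occurrences Gamma p)) //.
apply: eq_bigl => c; rewrite /is_cluster sw; congr (_ && _).
apply/andP/joinedP => [[_ /forallP cc] [|j] // lt_j|cj].
  have lt_j' : (j < n.-1)%N by lia.
  by have /exists_inP[a ac aj] := cc (Ordinal lt_j'); apply/crossedP; exists a.
split.
  (* As the length is at least 2, cut 1 is crossed; the crossing mark shows that [c] is nonempty. *)
  have /crossedP[a ac _] := cj 1%N n_ge2.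
  by apply/set0Pn; exists a.
apply/forallP => j; have lt_j : (j.+1 < n)%N by have := ltn_ord j; lia.
have /crossedP[a ac aj] := cj j.+1 lt_j.
by apply/exists_inP; exists a.
Qed.

End MarkedOccurrences.

End WordClusters.


(** * Infinite sums of series with growing order in x *)

Section InfiniteSums.
Variable R : comNzRingType.
Implicit Types (D : set nat) (F : nat -> fps3 R) (g : fps3 R).

(** Terms with index above [j] vanish at x^j, so each coefficient is a finite sum. *)
Lemma fps_sumE_order D F i j : (forall n, xorder_ge n (F n)) ->
  fps_sum D F i j = \sum_(n < j.+1 | (n : nat) \in D) F n i j.
Proof.
move=> FP; apply: fpsP => k; rewrite fps_sumE [LHS]/=.
rewrite (fsbigE [seq n <- index_iota 0 j.+1 | n \in D]).
- rewrite big_filter_cond -(big_mkord (fun n => n \in D) (fun n => F n i j k)).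
  by apply: eq_bigl => n; rewrite andbb.
- by rewrite filter_uniq ?iota_uniq.
- by move=> n; rewrite -[_ n]/(is_true (n \in _)) mem_filter => /andP[/set_mem].
move=> n Dn; rewrite mem_filter mem_set // mem_index_iota -leqNgt => lt_jn.
by rewrite FP.
Qed.

Lemma fps_sum_mulE D F g i j : (forall n, xorder_ge n (F n)) ->
  (g * fps_sum D F) i j = \sum_(n < j.+1 | (n : nat) \in D) (g * F n) i j.
Proof.
move=> FP; pose E := fps_sum D F - \sum_(n < j.+1 | (n : nat) \in D) F n.
have E_order : xorder_ge j.+1 E.
  move=> a b lt_bj.
  have -> : E a b =
      fps_sum D F a b - (\sum_(n < j.+1 | (n : nat) \in D) F n) a b by [].
  rewrite fps_sumE_order // !fps_sumE.
  apply/eqP; rewrite subr_eq0; apply/eqP.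
  rewrite (big_ord_widen_cond _ (fun n => n \in D) (fun n => F n a b) lt_bj).
  rewrite big_mkcond [RHS]big_mkcond; apply: eq_bigr => n _.
  by case: (_ \in D) => //=; case: ltnP => // lt_bn; rewrite FP.
have -> : fps_sum D F = E + \sum_(n < j.+1 | (n : nat) \in D) F n.
  by rewrite subrK.
rewrite mulrDr !fps_addE (xorder_geM (@xorder_ge0 _ g) E_order) // add0r.
by rewrite mulr_sumr !fps_sumE.
Qed.

End InfiniteSums.

(** * Coefficients after the substitution for [u] and [z] *)

Section Substitution.
Variable R : comNzRingType.
Local Notation t := (var_t R).
Local Notation s := (var_s R).
Variables u z : fps3 R.
Hypothesis uE : u = 4%:R * t / (1 + t) ^+ 2.
Hypothesis zE : z = (1 + t) * var_x R / (1 - t).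

Lemma zX n : z ^+ n = fps_const (fps_X (fps R) ^+ n) * ((1 + t) / (1 - t)) ^+ n.
Proof. by rewrite rmorphXn -exprMn; congr (_ ^+ n); rewrite zE /var_x; ring. Qed.

Lemma xorder_ge_zX n (f : fps3 R) : xorder_ge n (f * z ^+ n).
Proof.
apply: (xorder_geM (@xorder_ge0 _ f)); apply: xorder_geX.
rewrite zE; exact: xorder_ge_x.
Qed.

(** The power z^n is the factor of the chain series times x^n, which is constant in t. So only x^n
    survives, with a sum over words as its coefficient. *)
Lemma sum_ilpk_z n (h : 'S_n -> fps R) (H : seq nat -> fps R) i j :
  (forall p w, size w = n -> standardizes p w -> h p = H w) ->
  ((1 - t)^-1 *
     ((\sum_p fps_const (fps_const (h p)) * u ^+ ilpk p) * z ^+ n)) i j =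
  if n == j then \sum_(w <- words i.*2.+1 n) H w else 0.
Proof.
move=> hH; rewrite zX.
have swap (a b c d : fps3 R) : a * (b * (c * d)) = c * (a * b * d) by ring.
have series := @sum_ilpk_series _ n (fun p => fps_const (h p))
  (fun w => fps_const (H w)).
rewrite swap fps_const_mulE uE series => [|p w sw pw]; last by rewrite (hH p w).
rewrite fps_XnmulE; case: ltngtP => // [lt_nj|->]; rewrite /= -rmorph_sum /=.
  by rewrite subn_eq0 leqNgt lt_nj.
by rewrite subnn.
Qed.

Variable Gamma : set permutation.
Hypothesis hGamma : forall (m : nat) (q : 'S_m),
  Gamma (Tagged (fun m => 'S_m) q) -> (2 <= m)%N.

Let y : fps R := fps_X R - 1.

Lemma P_ilpk_z n i j :
  ((1 - t)^-1 * (P_ilpk Gamma n s u * z ^+ n)) i j =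
  if n == j then word_series Gamma y i.*2.+1 n else 0.
Proof.
case: n => [|n].
  rewrite !mulr1 fps_geometricE fps_oneE /= big_seq1 hits_short // cards0.
  by rewrite expr0 eq_sym; case: eqP.
have -> : P_ilpk Gamma n.+1 s u =
    \sum_(p : 'S_n.+1) fps_const (fps_const (fps_X R ^+ occ Gamma p)) * u ^+ ilpk p.
  by apply: eq_bigr => p _; rewrite !rmorphXn.
rewrite (@sum_ilpk_z _ _ (fun w => (1 + y) ^+ #|hits Gamma (size w) w|)) //.
move=> p w sw pw; rewrite (occ_hits hGamma sw pw) /y.
by rewrite addrC subrK.
Qed.

Lemma R_ilpk_z n i j : (2 <= n)%N ->
  ((1 - t)^-1 * (R_ilpk Gamma n (s - 1) u * z ^+ n)) i j =
  if n == j then block_series Gamma y i.*2.+1 n else 0.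
Proof.
move=> n_ge2; have -> : block_series Gamma y i.*2.+1 n =
    \sum_(w <- words i.*2.+1 n) block_weight Gamma y (size w) w.
  by case: (n) n_ge2.
have -> : R_ilpk Gamma n (s - 1) u = \sum_(p : 'S_n) fps_const (fps_const
    (\sum_(c : {set mark n} | is_cluster Gamma p c) y ^+ #|c|)) * u ^+ ilpk p.
  apply: eq_bigr => p _; rewrite mulrC; congr (_ * _).
  rewrite !rmorph_sum; apply: eq_bigr => c _.
  by rewrite !rmorphXn /y !rmorphB !rmorph1.
rewrite (@sum_ilpk_z _ _ (fun w => block_weight Gamma y (size w) w)) //.
by move=> p w sw pw; apply: cluster_block_weight.
Qed.

(** This is the contribution of the one permutation of length 1. It has no left peaks, and each
    one-letter word has only the empty set of marks, of weight 1. *)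
Lemma letter_z i j :
  (z / (1 - t)) i j = if j == 1%N then block_series Gamma y i.*2.+1 1 else 0.
Proof.
have -> : z / (1 - t) = (1 - t)^-1 *
    ((\sum_(p : 'S_1) fps_const (fps_const 1) * u ^+ ilpk p) * z ^+ 1).
  rewrite expr1 (big_pred1 1%g) => [|p]; last first.
    by apply/esym/eqP/permP => k; rewrite !ord1.
  have -> : ilpk (1%g : 'S_1) = 0%N.
    by rewrite /ilpk lpk_rise_falls /rise_falls big_ord0.
  by rewrite expr0 mulr1 !rmorph1 mul1r mulrC.
rewrite (@sum_ilpk_z _ _ (fun=> 1)) // eq_sym; case: eqP => // _.
apply: eq_big_seq => w /size_words sw.
rewrite /block_weight hits_short ?sw // (big_pred1 finset.set0) => [|c].
  by rewrite cards0.
rewrite finset.subset0 andb_idr // => /eqP ->.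
by apply/joinedP => -[|[]].
Qed.

End Substitution.

(** * Comparison of the coefficients of t^i x^j *)

Theorem theorem3p10 (R : comNzRingType) (Gamma : set permutation)
    (hGamma : forall (m : nat) (q : 'S_m),
       Gamma (Tagged (fun m => 'S_m) q) -> (2 <= m)%N) :
  let t := var_t R in
  let x := var_x R in
  let s := var_s R in
  let u : fps3 R := 4%:R * t / (1 + t) ^+ 2 in
  let z : fps3 R := (1 + t) * x / (1 - t) in
  (1 - t)^-1 * fps_sum setT (fun n => P_ilpk Gamma n s u * z ^+ n) =
  fps_sum setT (fun n =>
    hadamard_exp
      (z / (1 - t) +
       (1 - t)^-1 *
         fps_sum [set k | (2 <= k)%N]%classic (fun k => R_ilpk Gamma k (s - 1) u * z ^+ k))
      n).
Proof.
move=> t x s u z.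
have uE : u = 4%:R * var_t R / (1 + var_t R) ^+ 2 := erefl.
have zE : z = (1 + var_t R) * var_x R / (1 - var_t R) := erefl.
clearbody u z; rewrite {}/s {}/t {x}; set H := z / (1 - _) + _.
pose y : fps R := fps_X R - 1.
(* At t^i the base of the Hadamard powers is the series of blocks over 2i + 1 letters. *)
have H_blocks i : H i = block_series Gamma y i.*2.+1.
  apply: fpsP => j; rewrite !fps_addE (letter_z uE zE Gamma).
  rewrite fps_sum_mulE; last by move=> n; apply: (xorder_ge_zX zE).
  transitivity ((if j == 1%N then block_series Gamma y i.*2.+1 1 else 0) +
    \sum_(n < j.+1 | (2 <= n)%N)
      (if (n : nat) == j then block_series Gamma y i.*2.+1 n else 0)).
    congr (_ + _); apply: eq_big => n; first by rewrite mem_setE.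
    by rewrite mem_setE => n_ge2; rewrite (R_ilpk_z uE zE hGamma).
  (* No block is empty; those of length 1 come from z/(1 - t), and those of a length n >= 2 from the
     n-th term of the sum. *)
  case: j => [|[|j]].
  - by rewrite add0r big1 // => -[[|]].
  - by rewrite big1 ?addr0 // => -[[|[|]]].
  rewrite add0r (bigD1 ord_max) // eqxx -[RHS]addr0; congr (_ + _).
  by rewrite big1 // => n /andP[_]; rewrite -val_eqE => /negbTE /= ->.
have H_order : xorder_ge 1 H.
  by move=> i [|j] // _; rewrite H_blocks.
apply: fpsP => i; apply: fpsP => j.
rewrite fps_sum_mulE => [|n]; last exact: (xorder_ge_zX zE).
rewrite fps_sumE_order => [|n]; last exact: xorder_ge_hadamard_exp.
(* Both sides count words of length j over 2i + 1 letters by their hits. On the left only the term n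
   = j contributes. *)
transitivity (word_series Gamma y i.*2.+1 j).
  rewrite (bigD1 ord_max) ?in_setT // (P_ilpk_z uE zE hGamma) eqxx -[RHS]addr0.
  congr (_ + _); rewrite big1 // => n /andP[_]; rewrite -val_eqE => /negbTE ne_nj.
  by rewrite (P_ilpk_z uE zE hGamma) ne_nj.
(* Hadamard powers are powers of the coefficient of t^i, so the right-hand side is the geometric
   series in the block series. *)
rewrite -(fps_geometric_solution (F := block_series Gamma y i.*2.+1)) //; last first.
  exact: word_series_rec.
by apply: eq_big => n; rewrite ?in_setT // hadamard_expE H_blocks.
Qed.
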